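(* For any integer $n \geq 1$ and any $k \in \{1, \ldots, n\}$, there exist a complex Hilbert space $\mathcal H$ of dimension at most $1 + \sum_{j=0}^k \binom{n}{j}$, a unit vector $|\psi\rangle \in \mathcal H$, and $n$ qubits $(X_1, Z_1), \ldots, (X_n, Z_n)$ in $\mathcal H$ such that $$S^{(1)}_{j_1} \cdots S^{(k)}_{j_k} |\psi\rangle = S^{(\sigma(1))}_{j_{\sigma(1)}} \cdots S^{(\sigma(k))}_{j_{\sigma(k)}} |\psi\rangle$$ for all distinct indices $j_1, \ldots, j_k \in \{1,\ldots,n\}$, all $S^{(1)}, \ldots, S^{(k)} \in \{X, Z\}$, and all permutations $\sigma$ of $\{1, \ldots, k\}$.
   Context: A reflection is a Hermitian operator that squares to the identity. A qubit in a Hilbert space $\mathcal H$ is a pair $(X, Z)$ of anti-commuting reflections on $\mathcal H$, i.e. $XZ + ZX = 0$. For $S^{(\ell)} \in \{X, Z\}$, the symbol $S^{(\ell)}_{j}$ means $X_j$ or $Z_j$ according to the value of $S^{(\ell)}$. *)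

(* Defs.v *)
From mathcomp Require Import all_boot all_order all_algebra all_fingroup.
From mathcomp Require Import sesquilinear spectral complex reals.

Set Implicit Arguments.
Unset Strict Implicit.
Unset Printing Implicit Defensive.

Local Open Scope ring_scope.
Local Open Scope sesquilinear_scope.

(* The d-dimensional complex Hilbert space is C^d = 'cV[C]_d with the standard
   inner product <u|v> = u^t* *m v; operators on it are matrices acting on the
   left.  Every complex Hilbert space of dimension d is isometric to this one. *)

Definition unit_vector (C : numClosedFieldType) (d : nat) (psi : 'cV[C]_d) :
  Prop := psi^t* *m psi = 1%:M.

Definition reflection (C : numClosedFieldType) (d : nat) (A : 'M[C]_d) : Prop :=
  A \is hermsymmx /\ A *m A = 1%:M.

Definition qubit (C : numClosedFieldType) (d : nat) (X Z : 'M[C]_d) : Prop :=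
  [/\ reflection X, reflection Z & X *m Z + Z *m X = 0].

Inductive letter : Type := LX | LZ.

Definition select (T : Type) (X Z : T) (s : letter) : T :=
  match s with LX => X | LZ => Z end.

(* Main.v *)
(* Start from the standard n-qubit space with psi = |0...0>.  A word of length k
   only visits basis vectors |x> with |x| <= k, viewing x as a subset of 'I_n,
   and its m-th letter acts on some |x> with |x| < m <= k; so restrict to the
   span of these vectors.  There X_i is undefined exactly on the |x> with
   |x| = k and i not in x.  There are C(n - 1, k) of them: if that number is
   odd, add one more basis vector, then pair them up arbitrarily, letting X_i
   swap each pair and Z_i have opposite signs on it.  The words never see this
   choice: with distinct indices, Z_i always acts on some |x> with i not in x,
   hence trivially, and the word maps |0...0> to the |x> where x collects the
   indices of its X letters, whatever their order. *)

Require Import Defs.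
From mathcomp Require Import all_boot all_order all_algebra all_fingroup.
From mathcomp Require Import sesquilinear spectral complex reals.

Local Open Scope ring_scope.

Import GRing.Theory.

(** Combinatorial form of a qubit: [f] becomes X and the sign [s] becomes Z. The sign change rules
    out fixed points of [f] in [A]; outside [A] nothing is required. *)
Definition signed_matching {T : finType} (A : {set T}) (f : T -> T)
    (s : T -> bool) : Prop :=
  forall x, x \in A -> [/\ f x \in A, f (f x) = x & s (f x) = ~~ s x].

(** Two elements are removed, swapped and given opposite signs; the rest is matched by induction on
    half the cardinality. *)
Lemma even_signed_matching {T : finType} (A : {set T}) :
  ~~ odd #|A| -> exists f s, signed_matching A f s.
Proof.
move=> evA; have [n cardA] : exists n, #|A| = n.*2.
  by exists #|A|./2; rewrite even_halfK.
elim: n A cardA {evA} => [|n IHn] A cardA.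
  exists id, (fun=> true) => x; move/eqP: cardA.
  by rewrite cards_eq0 => /eqP->; rewrite inE.
have [x Ax] : exists x, x \in A by apply/card_gt0P; rewrite cardA.
have := cardsD1 x A; rewrite cardA Ax doubleS add1n => -[cardAx].
have [y Axy] : exists y, y \in A :\ x by apply/card_gt0P; rewrite -cardAx.
have := cardsD1 y (A :\ x); rewrite -cardAx Axy add1n => -[cardAxy].
have [f [s fs]] := IHn _ (esym cardAxy).
have /setD1P[yx Ay] := Axy.
exists (fun z => if z == x then y else if z == y then x else f z).
exists (fun z => if z == x then true else if z == y then false else s z).
move=> z Az; have [->|zx] := eqVneq z x; first by rewrite (negPf yx) eqxx.
have [->|zy] := eqVneq z y; first by rewrite eqxx.
have := fs z; rewrite !inE zx zy Az => -[] // /and3P[/negPf-> /negPf-> Afz].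
by move=> -> ->.
Qed.

(** An arbitrary matching of the even set [A :\: D] is glued to the given one; each piece is stable
    under its own map. *)
Lemma signed_matching_extension {T : finType} {A D : {set T}} {g : T -> T}
    {t : T -> bool} :
  signed_matching D g t -> D \subset A -> ~~ odd #|A :\: D| ->
  exists f s,
    signed_matching A f s /\ {in D, forall x, f x = g x /\ s x = t x}.
Proof.
move=> Dgt sDA /even_signed_matching[f [s fs]].
exists (fun x => if x \in D then g x else f x).
exists (fun x => if x \in D then t x else s x).
split=> [x Ax|x ->] //; case: (boolP (x \in D)) => Dx.
  by have [Dgx -> ->] := Dgt x Dx; rewrite Dgx (subsetP sDA).
have := fs x; rewrite !inE Dx Ax => -[] // /andP[/negPf-> ->] -> ->.
by [].
Qed.

Definition flip_mx (C : numClosedFieldType) {d : nat} (p : 'I_d -> 'I_d) :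
  'M[C]_d := \matrix_(a, b) (a == p b)%:R.

Definition sign_mx (C : numClosedFieldType) {d : nat} (s : 'I_d -> bool) :
  'M[C]_d := diag_mx (\row_b (-1) ^+ s b).

Lemma flip_mx_delta C d (p : 'I_d -> 'I_d) (b : 'I_d) :
  flip_mx C p *m delta_mx b 0 = delta_mx (p b) 0 :> 'cV_d.
Proof.
by rewrite -colE; apply/matrixP=> a c; rewrite !mxE ord1 eqxx andbT.
Qed.

Lemma sign_mx_delta C d (s : 'I_d -> bool) (b : 'I_d) :
  sign_mx C s *m delta_mx b 0 = (-1) ^+ s b *: delta_mx b 0 :> 'cV_d.
Proof.
rewrite /sign_mx mul_diag_mx; apply/matrixP=> a c; rewrite !mxE.
by case: eqP => [->|]; rewrite ?mulr0.
Qed.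

Lemma mx_eq_delta (C : numClosedFieldType) (d : nat) (A B : 'M[C]_d) :
  (forall b, A *m delta_mx b 0 = B *m delta_mx b 0 :> 'cV_d) -> A = B.
Proof.
move=> AB; apply/matrixP=> a b; have /matrixP/(_ a 0) := AB b.
by rewrite -!colE !mxE.
Qed.

(** Both matrices are real, so Hermitian reduces to symmetric, and the flip is symmetric because [p]
    is its own inverse. On a basis vector the two products differ by a sign, since [p] reverses
    [s]. *)
Lemma flip_sign_qubit C d (p : 'I_d -> 'I_d) (s : 'I_d -> bool) :
  involutive p -> (forall b, s (p b) = ~~ s b) ->
  qubit (flip_mx C p) (sign_mx C s).
Proof.
move=> pK sp; split; first split.
- apply: realsym_hermsym.
    apply/is_hermitianmxP; rewrite expr0 scale1r; apply/matrixP=> a b.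
    by rewrite !mxE eq_sym (can2_eq pK pK).
  by apply/mxOverP=> a b; rewrite mxE rpred_nat.
- by apply: mx_eq_delta => b; rewrite -mulmxA !flip_mx_delta pK mul1mx.
- split.
    apply: realsym_hermsym.
      by apply/is_hermitianmxP; rewrite expr0 scale1r map_mx_id // tr_diag_mx.
    apply/mxOverP=> a b; rewrite !mxE; case: eqP => _; rewrite ?mulr0n ?rpred0 //.
    by rewrite mulr1n rpredX ?rpredN ?rpred1.
  apply: mx_eq_delta => b; rewrite -mulmxA sign_mx_delta -scalemxAr.
  by rewrite sign_mx_delta scalerA -expr2 sqrr_sign scale1r mul1mx.
- apply: mx_eq_delta => b; rewrite mulmxDl -!mulmxA sign_mx_delta flip_mx_delta.
  rewrite sign_mx_delta -scalemxAr flip_mx_delta sp mul0mx.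
  by case: (s b); rewrite !(scaleN1r, scale1r) ?addNr ?subrr.
Qed.

(** The member [x0] of [V] only makes the rank total; the value is meaningful for [x] in [V]. *)
Definition ket (C : numClosedFieldType) {T : finType} {V : {set T}} {x0 : T}
    (x0V : x0 \in V) (x : T) : 'cV[C]_#|V| :=
  delta_mx (enum_rank_in x0V x) 0.

Lemma signed_matching_qubit (C : numClosedFieldType) {T : finType}
    {V : {set T}} {x0 : T} (x0V : x0 \in V) (f : T -> T) (s : T -> bool) :
  signed_matching V f s ->
  exists XZ : 'M[C]_#|V| * 'M[C]_#|V|,
    qubit XZ.1 XZ.2 /\
    {in V, forall x, XZ.1 *m ket C x0V x = ket C x0V (f x) /\
                     XZ.2 *m ket C x0V x = (-1) ^+ s x *: ket C x0V x}.
Proof.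
move=> fs; pose p b := enum_rank_in x0V (f (@enum_val _ (mem V) b)).
pose t b := s (@enum_val _ (mem V) b); exists (flip_mx C p, sign_mx C t).
split=> [|x Vx]; last first.
  by rewrite /= flip_mx_delta sign_mx_delta /p /t enum_rankK_in.
have pV b : enum_val (p b) = f (enum_val b).
  by rewrite enum_rankK_in //; case: (fs _ (enum_valP b)).
apply: flip_sign_qubit => b; last first.
  by rewrite /t pV; case: (fs _ (enum_valP b)).
by apply: enum_val_inj; rewrite !pV; case: (fs _ (enum_valP b)).
Qed.

(* [Some x] is the basis vector |x>, and [None] the extra one that makes the
   dimension even. *)
Definition low_weight (n k : nat) : {set option {set 'I_n}} :=
  [set t : option {set 'I_n} |
     if t is Some x then #|x| <= k else odd 'C(n.-1, k)]%N.

Lemma card_low_weight n k :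
  (#|low_weight n k| <= 1 + \sum_(0 <= j < k.+1) 'C(n, j))%N.
Proof.
have leT : (#|[set x : {set 'I_n} | (#|x| <= k)%N]| <=
            \sum_(0 <= j < k.+1) 'C(n, j))%N.
  (* Each induction step adds the layer of subsets of size exactly [k.+1]. *)
  elim: k => [|k IHk].
    rewrite big_nat1 -[X in 'C(X, _)]card_ord -card_draws.
    by apply/eq_leq/eq_card=> x; rewrite !inE leqn0.
  rewrite big_nat_recr //= -[X in 'C(X, _)]card_ord -card_draws.
  apply: leq_trans (leq_add IHk (leqnn _)).
  apply: leq_trans (leq_card_setU _ _).
  by apply/subset_leq_card/subsetP=> x; rewrite !inE leq_eqVlt orbC.
apply: leq_trans (leq_add (leqnn 1%N) leT).
(* The summand 1 pays for [None], whatever the parity. *)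
rewrite -(cards1 (None : option {set 'I_n})).
rewrite -(card_imset [set x : {set 'I_n} | (#|x| <= k)%N] (@Some_inj _)).
apply: leq_trans (leq_card_setU _ _).
apply/subset_leq_card/subsetP=> -[x|]; rewrite !inE //= => lexk.
by rewrite imset_f ?inE.
Qed.

Definition toggle {n : nat} (i : 'I_n) (x : {set 'I_n}) : {set 'I_n} :=
  if i \in x then x :\ i else i |: x.

(* The basis vectors |x> such that both x and [toggle i x] have low weight. *)
Definition toggled {n : nat} (k : nat) (i : 'I_n) : {set option {set 'I_n}} :=
  [set t : option {set 'I_n} | if t is Some x then #|x :\ i| < k else false]%N.

Lemma toggled_sub n k (i : 'I_n) : toggled k i \subset low_weight n k.
Proof.
apply/subsetP=> -[x|]; rewrite !inE // (cardsD1 i x) => ltxk.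
by case: (i \in x); rewrite // ltnW.
Qed.

(** Toggling [i] preserves [x :\ i], hence stability, and reverses membership of [i], hence the
    sign. The default [set0] is never reached, as [None] is not in [toggled k i]. *)
Lemma toggled_matching n k (i : 'I_n) :
  signed_matching (toggled k i) (omap (toggle i)) (fun t => i \in odflt set0 t).
Proof.
move=> [x|]; rewrite !inE //= /toggle => ltxk.
have [ix|ix] := boolP (i \in x); rewrite !inE eqxx /=.
  split=> //; last by rewrite setD1K.
  by apply: leq_ltn_trans ltxk; rewrite subset_leq_card // subD1set.
by split=> //; rewrite ?setU1K //; rewrite (cardsD1 i x) (negPf ix).
Qed.

Lemma even_untoggled n k (i : 'I_n) : ~~ odd #|low_weight n k :\: toggled k i|.
Proof.
(* An untoggled [Some x] has [#|x| <= k <= #|x :\ i|], so [i] is outside [x] and [#|x| = k]: this is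
   [B], with ['C(n.-1, k)] elements. [E] corrects the parity. *)
pose E := if odd 'C(n.-1, k) then [set None : option {set 'I_n}] else set0.
pose B := [set x : {set 'I_n} | x \subset ~: [set i] & #|x| == k].
have -> : low_weight n k :\: toggled k i = E :|: Some @: B.
  apply/setP=> -[x|]; rewrite !inE; last first.
    rewrite /E; case: ifP; rewrite !inE //= => _.
    by apply/esym/negbTE/imsetP=> -[].
  rewrite (mem_imset _ _ (@Some_inj _)) inE -disjoints_subset disjoint_sym.
  rewrite disjoints1 (cardsD1 i x) -leqNgt /E.
  have -> : (Some x \in if odd 'C(n.-1, k) then [set None] else set0) = false.
    by case: ifP; rewrite !inE.
  case: (i \in x) => /=; last by rewrite eqn_leq andbC.
  by rewrite add1n; case: leqP.
rewrite cardsU disjoint_setI0 ?cards0 ?subn0; last first.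
  rewrite /E; case: ifP => _; last by rewrite -setI_eq0 set0I.
  by rewrite disjoints1; apply/imsetP=> -[].
rewrite (card_imset _ (@Some_inj _)) cards_draws cardsC1 card_ord oddD /E.
by case: ifP; rewrite ?cards1 ?cards0.
Qed.

Lemma toggle_qubit (C : numClosedFieldType) n k
    (x0V : Some set0 \in low_weight n k) (i : 'I_n) :
  exists XZ : 'M[C]_#|low_weight n k| * 'M[C]_#|low_weight n k|,
    qubit XZ.1 XZ.2 /\
    forall x : {set 'I_n}, i \notin x -> (#|x| < k)%N ->
      XZ.1 *m ket C x0V (Some x) = ket C x0V (Some (i |: x)) /\
      XZ.2 *m ket C x0V (Some x) = ket C x0V (Some x).
Proof.
have [f [s [fs eq_fs]]] := signed_matching_extension (toggled_matching n k i)
  (toggled_sub n k i) (even_untoggled n k i).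
have [XZ [qXZ actXZ]] := signed_matching_qubit C x0V f s fs.
exists XZ; split=> // x ix ltxk.
(* Here [Some x] lies in [toggled k i], where the extension agrees with the standard action. *)
have [|fx sx] := eq_fs (Some x).
  by rewrite inE (leq_ltn_trans _ ltxk) // subset_leq_card ?subD1set.
have [|-> ->] := actXZ (Some x); first by rewrite inE ltnW.
by rewrite fx sx /= /toggle (negPf ix) expr0 scale1r.
Qed.

Definition is_LX (l : letter) : bool := if l is LX then true else false.

Lemma word_ket (C : numClosedFieldType) n k
    (x0V : Some set0 \in low_weight n k)
    (X Z : 'I_n -> 'M[C]_#|low_weight n k|) :
  (forall i (x : {set 'I_n}), i \notin x -> (#|x| < k)%N ->
      X i *m ket C x0V (Some x) = ket C x0V (Some (i |: x)) /\
      Z i *m ket C x0V (Some x) = ket C x0V (Some x)) ->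
  forall (j : 'I_k -> 'I_n) (S : 'I_k -> letter), injective j ->
    (\big[mulmx/1%:M]_(l < k) select (X (j l)) (Z (j l)) (S l))
      *m ket C x0V (Some set0) = ket C x0V (Some (j @: [set l | is_LX (S l)])).
Proof.
move=> actXZ j S inj_j.
have -> : [set l | is_LX (S l)] = [set l in index_enum 'I_k | is_LX (S l)].
  by apply/setP=> l; rewrite !inE mem_index_enum.
(* The induction runs over any duplicate-free list of at most [k] positions, adding letters on the
   left. *)
have: (size (index_enum 'I_k) <= k)%N.
  by rewrite -(card_uniqP (index_enum_uniq _)) -[leqRHS]card_ord max_card.
have: uniq (index_enum 'I_k) by exact: index_enum_uniq.
elim: (index_enum 'I_k) => [|l r IHr] /=.
  have -> : [set l in [::] | is_LX (S l)] = set0.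
    by apply/setP=> l; rewrite !inE.
  by rewrite big_nil mul1mx imset0.
case/andP=> lr uniq_r lt_rk; rewrite big_cons -mulmxA IHr //; last exact: ltnW.
set x := j @: [set m in r | _].
(* Injectivity of [j] keeps the new index outside [x]; the strict bound on [size r] gives
   [#|x| < k]. *)
have jlx : j l \notin x by rewrite mem_imset // inE (negPf lr).
have [|Xx Zx] := actXZ (j l) x jlx.
  apply: leq_ltn_trans lt_rk; rewrite card_imset // -(card_uniqP uniq_r).
  by apply/subset_leq_card/subsetP=> m; rewrite !inE => /andP[].
have -> : [set m in l :: r | is_LX (S m)] =
          if is_LX (S l) then l |: [set m in r | is_LX (S m)]
          else [set m in r | is_LX (S m)].
  apply/setP=> m; case Sl: (is_LX (S l)); rewrite !inE andb_orl;
  by case: eqP => // ->; rewrite Sl.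
by case: (S l); rewrite /= ?Xx ?Zx // imsetU1.
Qed.

Theorem lemma4p2 (R : realType) (n k : nat) (hn : (1 <= n)%N)
    (hk : (1 <= k <= n)%N) :
  exists (d : nat) (psi : 'cV[R[i]]_d) (X Z : 'I_n -> 'M[R[i]]_d),
    [/\ (d <= 1 + \sum_(0 <= j < k.+1) 'C(n, j))%N,
        unit_vector psi,
        forall m : 'I_n, qubit (X m) (Z m)
      & forall (j : 'I_k -> 'I_n) (S : 'I_k -> letter) (sigma : 'S_k),
          injective j ->
          (\big[mulmx/1%:M]_(l < k) select (X (j l)) (Z (j l)) (S l)) *m psi =
          (\big[mulmx/1%:M]_(l < k)
             select (X (j (sigma l))) (Z (j (sigma l))) (S (sigma l))) *m psi].
Proof.
have x0V : Some set0 \in low_weight n k by rewrite inE cards0.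
have [XZ XZP] := fin_all_exists (toggle_qubit R[i] n k x0V).
exists #|low_weight n k|, (ket R[i] x0V (Some set0)).
exists (fun i => (XZ i).1), (fun i => (XZ i).2).
have act i := (XZP i).2.
split=> [||i|j S sigma inj_j]; first exact: card_low_weight.
- rewrite /unit_vector /ket trmx_delta map_delta_mx mul_delta_mx.
  by apply/matrixP=> a b; rewrite !ord1 !mxE.
- by case: (XZP i).
rewrite (word_ket _ _ _ _ _ _ act) //.
rewrite (word_ket _ _ _ _ _ _ act (j \o sigma) (S \o sigma)); last first.
  exact: inj_comp inj_j perm_inj.
(* Both words reach the set of indices of X letters, which [sigma] merely reindexes. *)
congr (ket _ _ (Some _)); apply/setP=> i.
apply/imsetP/imsetP=> -[l]; rewrite inE => Sl ->; last first.
  by exists (sigma l); rewrite ?inE.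
by exists ((sigma^-1)%g l); rewrite ?inE /= permKV.
Qed.
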